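(* Let $(\chi_n)_{n\ge1}$, $f$, $a$, $H$, $f^H$, $b_1$, $F$, $b$ be as in the context, with $b_1\ge b$. Let $l>0$ satisfy $$l<\min\{H-f^H,\;F(a)\}\qquad\text{and}\qquad l<b-f(b)=-F(b),$$ and let $u_l,v_l,\alpha_l,\beta_l$ and $p_1,K_1,p_2,K_2$ be defined as in the context. Let $(x_n)$ be the solution of $x_{n+1}=\max\{f(x_n)+l\chi_{n+1},0\}$, $n=0,1,2,\dots$, with initial value $x_0\in[0,H]$. Then: (i) If $x_0\in(\alpha_l,H]$, then the solution $x_n$ will eventually get into the interval $[a,H]$ with a (persistence) probability $P_p$ such that $P_p\ge p_1^{K_1}$. (ii) If $x_0\in[0,\beta_l)$, then the solution $x_n$ will eventually get into the interval $[0,b]$ with a (''low density'') probability $P_e$ such that $P_e\ge p_2^{K_2}$.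
   Context: $(\chi_n)_{n\ge1}$ is a sequence of independent identically distributed continuous real random variables with zero mean on a complete probability space $(\Omega,\mathcal F,\mathbb P)$, whose common density $\phi$ satisfies $\phi(x)>0$ for $x\in(-1,1)$ and $\phi(x)=0$ for $x\notin[-1,1]$; $\chi$ denotes a random variable with this law. $f:[0,\infty)\to[0,\infty)$ is continuous, $f(0)=0$, $f(x)>0$ for $x>0$, and there are fixed positive numbers $a<H$ such that (1) $f^H:=\max_{x\in[0,H]}f(x)<H$; (2) $f(x)>f(a)>a$ for all $x\in(a,H]$. Moreover $b_1>0$ is a point such that $f(x)<x$ and $f(x)\le f(b_1)$ for all $x\in(0,b_1)$. $F(x):=f(x)-x$ for $x\in[0,\infty)$, and $b:=\min\{\beta>0:\ F(\beta)=\min_{x\in[0,a]}F(x)\}$ (with $\beta$ ranging over $(0,a]$). Define $$u_l:=\sup\{u<a: F(u)<l\},\qquad v_l:=\inf\{v>b: F(v)>-l\},$$ $$\beta_l:=\inf\{b<x<a: F(x)>l\},\qquad \alpha_l:=\sup\{b<x<a: F(x)<-l\}.$$ $[t]$ is the integer part of $t\ge0$. For $x_0\in(\alpha_l,u_l]$: $A=A(x_0):=\min_{x\in[x_0,u_l]}F(x)>-l$, $$p_1:=\mathbb P\Big\{\chi\ge 1-\frac{l+A}{2l}\Big\},\qquad K_1:=\Big[\frac{2(u_l-x_0)}{l+A}\Big]+1.$$ For $x_0\in[v_l,\beta_l)$: $B=B(x_0):=\max_{x\in[v_l,x_0]}F(x)<l$, $$p_2:=\mathbb P\Big\{\chi\le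 -1+\frac{l-B}{2l}\Big\},\qquad K_2:=\Big[\frac{2(x_0-v_l)}{l-B}\Big]+1.$$ For $x_0\in(u_l,H]$ the bound $p_1^{K_1}$, and for $x_0\in[0,v_l)$ the bound $p_2^{K_2}$, is understood as $1$. The initial value $x_0$ is deterministic. *)

(* Defs.v *)
From HB Require Import structures.
From mathcomp Require Import all_boot all_order all_algebra.
From mathcomp Require Import finmap.
From mathcomp Require Import all_classical all_reals all_analysis.
Import Order.TTheory GRing.Theory Num.Theory.
Import numFieldNormedType.Exports.

Set Implicit Arguments.
Unset Strict Implicit.
Unset Printing Implicit Defensive.

Local Open Scope classical_set_scope.
Local Open Scope ring_scope.

(* Least and greatest element of a set of reals; the default 0 is returned when
   there is none. *)
Definition set_min (R : realType) (S : set R) : R := xget 0 (S `&` lbound S).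
Definition set_max (R : realType) (S : set R) : R := xget 0 (S `&` ubound S).

Section Probability.
Context {d : measure_display} {T : measurableType d} {R : realType}
  (P : probability T R).

Definition has_density (X : {RV P >-> R}) (phi : R -> R) : Prop :=
  [/\ measurable_fun [set: R] phi,
      (forall x, 0 <= phi x) &
      (forall A : set R, measurable A ->
        distribution P X A = (\int[lebesgue_measure]_(x in A) (phi x)%:E)%E)].

Definition mutually_independent (D : set nat) (X : nat -> {RV P >-> R}) : Prop :=
  forall (J : {fset nat}) (A : nat -> set R),
    [set` J] `<=` D -> (forall i, measurable (A i)) ->
    P (\bigcap_(i in [set` J]) (X i @^-1` A i))
      = (\prod_(i <- J) P (X i @^-1` A i))%E.

End Probability.

(* Functions on [0, +oo[ are represented by functions on R of which only the
   values on [0, +oo[ are used. *)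
Section Equation.
Context {R : realType}.
Implicit Types (f : R -> R) (a H b l x : R).

Definition fmax f H : R := set_max (f @` `[0, H]).

Definition F f (x : R) : R := f x - x.

Definition argminF f a : R :=
  set_min [set beta | 0 < beta <= a /\ F f beta = set_min (F f @` `[0, a])].

Definition u_ f a l : R := sup [set u | [/\ 0 <= u, u < a & F f u < l]].
Definition v_ f b l : R := inf [set v | b < v /\ - l < F f v].
Definition beta_ f a b l : R := inf [set x | b < x < a /\ l < F f x].
Definition alpha_ f a b l : R := sup [set x | b < x < a /\ F f x < - l].

Definition A_ f a l x0 : R := set_min (F f @` `[x0, u_ f a l]).
Definition B_ f b l x0 : R := set_max (F f @` `[v_ f b l, x0]).

Definition K1 f a l x0 : nat :=
  (Num.truncn (2 * (u_ f a l - x0) / (l + A_ f a l x0))).+1.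
Definition K2 f b l x0 : nat :=
  (Num.truncn (2 * (x0 - v_ f b l) / (l - B_ f b l x0))).+1.

Context {d : measure_display} {T : measurableType d} (P : probability T R).

Definition p1 (X : {RV P >-> R}) f a l x0 : \bar R :=
  P [set w | 1 - (l + A_ f a l x0) / (2 * l) <= X w].
Definition p2 (X : {RV P >-> R}) f b l x0 : \bar R :=
  P [set w | X w <= - 1 + (l - B_ f b l x0) / (2 * l)].

Definition persistence_bound (X : {RV P >-> R}) f a l x0 : \bar R :=
  if u_ f a l < x0 then 1%E else (p1 X f a l x0 ^+ K1 f a l x0)%E.
Definition low_density_bound (X : {RV P >-> R}) f b l x0 : \bar R :=
  if x0 < v_ f b l then 1%E else (p2 X f b l x0 ^+ K2 f b l x0)%E.

(* The noise is indexed from 1: the term [chi_ 0] is never used. *)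
Fixpoint solution f l (chi_ : nat -> {RV P >-> R}) x0 (n : nat) (w : T) : R :=
  if n is m.+1 then
    Num.max (f (solution f l chi_ x0 m w) + l * chi_ m.+1 w) 0
  else x0.

End Equation.

(* The process enters I and remains there from some time on. *)
Definition settles_in (T : Type) (R : realType) (x : nat -> T -> R) (I : set R) :
  set T := [set w | exists N, forall n, (N <= n)%N -> I (x n w)].

(* The process enters I at some time.  This is the event used for the low
   density interval [0, b], which, unlike [a, H], need not be absorbing: f may
   exceed f b on ]0, b[, and from there the noise can carry a solution beyond a,
   after which it never returns. *)
Definition gets_into (T : Type) (R : realType) (x : nat -> T -> R) (I : set R) :
  set T := [set w | exists n, I (x n w)].

(* Main.v *)
(* Above u_l the drift F >= l outweighs any noise of size at most l, so the
   solution never decreases before it reaches [a, H], which is absorbing; since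
   almost surely chi_n > -1/2 infinitely often, it climbs by l / 2 infinitely
   often and does reach [a, H].  From x_0 <= u_l, as long as the solution is in
   [x_0, u_l], noise with chi_n >= 1 - (l + A) / (2 l) pushes it up by at least
   A + l - (l + A) / 2 = (l + A) / 2, so K_1 such steps in a row, an event of
   probability p_1 ^ K_1, carry it past u_l.  The low density case is the mirror
   image, with v_l, b and chi_n < 1/2. *)
Require Import Defs.
From HB Require Import structures.
From mathcomp Require Import all_boot all_order all_algebra.
From mathcomp Require Import finmap.
From mathcomp Require Import ring lra.
From mathcomp Require Import all_classical all_reals all_analysis.
From mathcomp Require Import measurable_realfun.
Import Order.TTheory GRing.Theory Num.Theory.
Import numFieldNormedType.Exports.
Local Open Scope classical_set_scope.
Local Open Scope ring_scope.

(** * Null sets, densities and blocks of independent noise *)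

Section Probability.
Context (R : realType) (d : measure_display) (T : measurableType d)
  (P : probability T R).

(** The part of [A] outside [B] lies in [N], so it has probability 0. Pathwise inclusions then need
    checking only off a null set of noise paths. *)
Lemma le_measure_mod_negligible (A B N : set T) :
  measurable A -> measurable B -> P.-negligible N -> A `<=` B `|` N ->
  (P A <= P B)%E.
Proof.
move=> mA mB negN AsubBN.
have mAB : measurable (A `\` B) by exact: measurableD.
have PAB : P (A `\` B) = 0%E.
  apply: measure_negligible => //; apply: negligibleS negN.
  by move=> w [/AsubBN[]].
have -> : P A = (P (A `&` B) + P (A `\` B))%E.
  rewrite -measureU ?setUIDK //; first exact: measurableI.
  by apply/seteqP; split=> w // [[_ ?] []].
rewrite PAB adde0; apply: le_measure; rewrite ?inE//.
exact: measurableI.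
Qed.

Section Density.
Context (phi : R -> R) (X : {RV P >-> R}) (X_phi : has_density X phi).
Context (phi_pos : forall x, -1 < x < 1 -> 0 < phi x)
  (phi_out : forall x, ~~ (-1 <= x <= 1) -> phi x = 0).

(** [A] can meet [-1, 1] only at its two endpoints, a Lebesgue null set, and [phi] vanishes on the
    rest of [A]. *)
Lemma density_null (A : set R) :
  measurable A -> (forall x, A x -> ~~ (-1 < x < 1)) -> P (X @^-1` A) = 0%E.
Proof.
move=> mA Aout; have [mphi phi0 /(_ A mA)] := X_phi.
rewrite /distribution /pushforward => ->.
rewrite (@ge0_ae_eq_integral _ _ _ _ _ _ (cst 0%E)) ?integral0 //=.
- apply/measurable_EFinP; exact: measurable_funTS.
- by move=> x _; rewrite lee_fin.
- have : lebesgue_measure.-negligible ([set -1; 1] : set R).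
    apply: negligibleU; apply/negligibleP => //;
    exact: lebesgue_measure_set1.
  apply: negligibleS => x /= /not_implyP[Ax phix].
  have := Aout _ Ax; have : -1 <= x <= 1.
    by apply: contra_notT phix => /phi_out ->.
  by move=> /andP[]; rewrite !le_eqVlt => /orP[/eqP<-|->] /orP[/eqP->|->] //; tauto.
Qed.

(** A zero integral would make [phi] vanish almost everywhere on ]r, s[, an interval of positive
    length on which it is positive. *)
Lemma density_pos (r s : R) :
  -1 <= r -> r < s -> s <= 1 -> (0 < P (X @^-1` `]r, s[))%E.
Proof.
move=> r_ge rs s_le; rewrite lt0e measure_ge0 andbT; apply/eqP.
have [mphi phi0 /(_ `]r, s[%classic)] := X_phi.
rewrite /distribution /pushforward => -> // int0.
have : (\int[lebesgue_measure]_(x in `]r, s[) `|(phi x)%:E|)%E = 0%E.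
  by rewrite -int0; apply: eq_integral => x _; rewrite gee0_abs// lee_fin.
move=> /ae_eq_integral_abs-/(_ (measurable_itv _)) [].
  by apply/measurable_EFinP; exact: measurable_funTS.
move=> N [mN N0 subN]; have : lebesgue_measure `]r, s[%classic = 0%E :> \bar R.
  apply: subset_measure0 N0 => //.
  move=> x /= xrs; apply: subN => /(_ xrs) /eqP; rewrite eqe => /eqP phix0.
  have : 0 < phi x by apply: phi_pos; move: xrs; rewrite in_itv/= => /andP[]; lra.
  by rewrite phix0 ltxx.
by rewrite lebesgue_measure_itv/= lte_fin rs EFinN -EFinB => -[]; lra.
Qed.

(** The complementary event contains that of [X] falling in ]r, s[, which has positive
    probability. *)
Lemma density_lt1 (A : set R) (r s : R) :
  measurable A -> (forall x, r < x < s -> ~ A x) ->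
  -1 <= r -> r < s -> s <= 1 -> (P (X @^-1` A) < 1)%E.
Proof.
move=> mA Ars r_ge rs s_le; have Prs := density_pos _ _ r_ge rs s_le.
have mX B : measurable B -> measurable (X @^-1` B).
  by move=> mB; exact: measurable_funPTI.
have : (P (X @^-1` A) <= P (~` (X @^-1` `]r, s[%classic)))%E.
  apply: le_measure; rewrite ?inE; [exact: mX|exact/measurableC/mX|].
  by move=> w Aw /=; rewrite in_itv/= => /Ars.
move=> /le_lt_trans; apply; rewrite probability_setC; last exact: mX.
by rewrite lteBlDr ?lteDl// fin_num_measure//; exact: mX.
Qed.

End Density.

Section Independence.
Context (chi_ : nat -> {RV P >-> R}) (A : set R).
Context (indep : mutually_independent [set n | (1 <= n)%N] chi_)
  (mA : measurable A).

Lemma indep_block (p : \bar R) (m K : nat) :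
  (1 <= m)%N -> (forall n, (1 <= n)%N -> P (chi_ n @^-1` A) = p) ->
  P [set w | forall i, (m <= i < m + K)%N -> A (chi_ i w)] = (p ^+ K)%E.
Proof.
move=> m_ge1 Ap; have := indep [fset i in iota m K]%fset (fun=> A).
have memJ i : (i \in [fset i in iota m K]%fset) = (m <= i < m + K)%N.
  by rewrite !inE /= mem_iota.
have -> : \bigcap_(i in [set` [fset i in iota m K]%fset]) (chi_ i @^-1` A) =
          [set w | forall i, (m <= i < m + K)%N -> A (chi_ i w)].
  by apply/seteqP; split=> w /= Aw i; move: (Aw i); rewrite /= memJ.
move=> ->//; last by move=> i /=; rewrite memJ => /andP[/(leq_trans m_ge1)].
rewrite (perm_big (iota m K)) /=; last first.
  apply: uniq_perm; rewrite ?iota_uniq ?fset_uniq// => i.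
  by rewrite memJ mem_iota.
rewrite (eq_big_seq (fun=> p)); last first.
  by move=> i; rewrite mem_iota => /andP[/(leq_trans m_ge1) /Ap].
by rewrite big_const_seq count_predT size_iota iter_mule mule1.
Qed.

(** Staying in [A] from index m + 1 on implies staying in it over a block of any length k, an event
    of probability p ^ k, which tends to 0. The union over m is countable, hence still null. *)
Lemma not_eventually (p : \bar R) :
  (p < 1)%E -> (forall n, (1 <= n)%N -> P (chi_ n @^-1` A) = p) ->
  P.-negligible [set w | exists m, forall i, (m < i)%N -> A (chi_ i w)].
Proof.
move=> p_lt1 Ap.
have -> : [set w | exists m, forall i, (m < i)%N -> A (chi_ i w)] =
          \bigcup_m [set w | forall i, (m < i)%N -> A (chi_ i w)].
  by apply/seteqP; split=> w [m]; [exists m|exists m].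
apply: negligible_bigcup => m.
have mX i : measurable (chi_ i @^-1` A) by exact: measurable_funPTI.
have mfin k : measurable [set w | forall i, (m.+1 <= i < m.+1 + k)%N -> A (chi_ i w)].
  rewrite (_ : [set _ | _] =
    \bigcap_(i in [set i | (m.+1 <= i < m.+1 + k)%N]) chi_ i @^-1` A) //.
  by apply: bigcap_measurableType => i _.
have minf : measurable [set w | forall i, (m < i)%N -> A (chi_ i w)].
  rewrite (_ : [set _ | _] =
    \bigcap_(i in [set i | (m < i)%N]) chi_ i @^-1` A) //.
  by apply: bigcap_measurableType => i _.
apply/negligibleP => //; apply/eqP; rewrite eq_le measure_ge0 andbT.
have p_ge0 : (0 <= p)%E by rewrite -(Ap 1%N).
have p_fin : p \is a fin_num.
  by rewrite ge0_fin_numE//; apply: lt_trans p_lt1 _; rewrite ltry.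
have : (fine p) ^+ k @[k --> \oo] --> (0 : R).
  apply: cvg_expr; rewrite ger0_norm ?fine_ge0//.
  by rewrite -lte_fin fineK.
move=> /cvgrPdist_le cvgp; apply/lee_addgt0Pr => e e_gt0; rewrite add0e.
have [k _ /(_ k (leqnn k))] := cvgp e e_gt0.
rewrite sub0r normrN ger0_norm ?exprn_ge0 ?fine_ge0// => pk.
rewrite -lee_fin EFin_expe fineK// in pk; apply: le_trans pk.
rewrite -(@indep_block p m.+1 k)//; apply: le_measure; rewrite ?inE//.
by move=> w Aw i /andP[/Aw].
Qed.

End Independence.
End Probability.

(** * Real sequences that rise by fixed amounts *)

Section Climbing.
Context (R : realType).
Implicit Types (x : nat -> R) (delta : R).

(** If u were never exceeded, K gains of [delta] would still carry the sequence past u. The premise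
    [x n.+1 <= u] is available under this absurd assumption; in the descent it keeps the truncation
    at 0 inactive. *)
Lemma climb_steps x (u delta : R) (K : nat) :
  (forall n, (n < K)%N -> x 0%N <= x n <= u -> x n.+1 <= u ->
     x n + delta <= x n.+1) ->
  0 < delta -> u - x 0%N < K%:R * delta -> exists n, u < x n.
Proof.
move=> step d_gt0 K_gt; apply: contrapT => /forallNP nope.
have xle n : x n <= u by rewrite leNgt; apply/negP/nope.
have climb n : (n <= K)%N -> x 0%N + n%:R * delta <= x n.
  elim: n => [|n IH] nK; first by rewrite mul0r addr0.
  have := IH (ltnW nK) => xn.
  apply: le_trans (step n nK _ _) => //; first by rewrite -natr1 mulrDl mul1r addrA lerD2r.
  by rewrite xle andbT; apply: le_trans xn; rewrite lerDl mulr_ge0// ltW.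
by have := climb K (leqnn K); have := xle K; lra.
Qed.

(** A sequence below c from m on would never decrease, hence would stay above [lo] and gain [delta]
    at infinitely many indices, which is impossible. *)
Lemma climb_inf_often x (lo c delta : R) (m : nat) (g : set nat) :
  0 < delta -> lo < x m ->
  (forall n, (m <= n)%N -> lo < x n < c ->
     x n <= x n.+1 /\ (g n -> x n + delta <= x n.+1)) ->
  (forall n, exists2 k, (n <= k)%N & g k) ->
  exists2 n, (m <= n)%N & c <= x n.
Proof.
move=> d_gt0 lo_xm step g_io; apply: contrapT => /forall2NP nope.
have xlt n : (m <= n)%N -> x n < c.
  by move=> mn; case: (nope n) => [/(_ mn)//|/negP]; rewrite -ltNge.
have mono j k : (m <= j)%N -> x m <= x j -> x j <= x (j + k)%N.
  move=> mj xmj; elim: k => [|k IH]; first by rewrite addn0.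
  have mjk : (m <= j + k)%N by rewrite (leq_trans mj)// leq_addr.
  apply: le_trans (IH) _; rewrite addnS; apply: (step _ mjk _).1.
  by rewrite xlt// andbT (lt_le_trans lo_xm)// (le_trans xmj).
have climb k : exists2 n, (m <= n)%N & x m + k%:R * delta <= x n.
  elim: k => [|k [n mn xn]]; first by exists m; rewrite ?mul0r ?addr0.
  have [j nj gj] := g_io n; exists j.+1; first by rewrite leqW// (leq_trans mn).
  have xmn : x m <= x n.
    by apply: le_trans xn; rewrite lerDl mulr_ge0// ltW.
  have xnj : x n <= x j by have := mono n (j - n)%N mn xmn; rewrite subnKC.
  have [|_ /(_ gj)] := step j (leq_trans mn nj).
    by rewrite xlt ?(leq_trans mn)// andbT (lt_le_trans lo_xm)// (le_trans xmn).
  by apply: le_trans; rewrite -natr1 mulrDl mul1r addrA lerD2r (le_trans xn).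
(* This many gains of [delta] exceed the distance from x m to c. *)
have [n mn] := climb (Num.truncn ((c - x m) / delta)).+1.
have := truncnS_gt ((c - x m) / delta); rewrite ltr_pdivrMr//.
by have := xlt n mn; lra.
Qed.

End Climbing.

(** * Extrema of continuous functions on a segment *)

Section Extrema.
Context (R : realType).

(** The least element c rules out the default value 0 of [set_min]. *)
Lemma set_minP (S : set R) (c : R) : S c -> lbound S c ->
  S (set_min S) /\ lbound S (set_min S).
Proof. by move=> Sc lbc; apply: (@xgetPex _ 0 (S `&` lbound S)); exists c. Qed.

Lemma set_maxP (S : set R) (c : R) : S c -> ubound S c ->
  S (set_max S) /\ ubound S (set_max S).
Proof. by move=> Sc ubc; apply: (@xgetPex _ 0 (S `&` ubound S)); exists c. Qed.

Context (g : R -> R) (r s : R) (g_cont : {within `[r, s], continuous g}).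

Lemma set_min_le x : r <= x <= s -> set_min (g @` `[r, s]) <= g x.
Proof.
move=> xrs; have rs : r <= s by move/andP: xrs => []; exact: le_trans.
have [c crs gc] := EVT_min rs g_cont.
have [] := @set_minP (g @` `[r, s]) (g c).
- by exists c.
- by move=> _ [y yrs <-]; exact: gc.
by move=> _ lb; apply: lb; exists x => //=; rewrite in_itv.
Qed.

Lemma le_set_max x : r <= x <= s -> g x <= set_max (g @` `[r, s]).
Proof.
move=> xrs; have rs : r <= s by move/andP: xrs => []; exact: le_trans.
have [c crs gc] := EVT_max rs g_cont.
have [] := @set_maxP (g @` `[r, s]) (g c).
- by exists c.
- by move=> _ [y yrs <-]; exact: gc.
by move=> _ ub; apply: ub; exists x => //=; rewrite in_itv.
Qed.

End Extrema.

(** * Pathwise dynamics under bounded noise *)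

Section Dynamics.
Context (R : realType) (f : R -> R) (l : R) (x c : nat -> R).
Context (f_ge0 : forall y, 0 <= y -> 0 <= f y) (l_gt0 : 0 < l)
  (xS : forall n, x n.+1 = Num.max (f (x n) + l * c n.+1) 0)
  (c_bnd : forall n, (1 <= n)%N -> -1 <= c n <= 1).

Lemma scaled_noise_bound n : - l <= l * c n.+1 <= l.
Proof.
have /andP[c_ge c_le] := c_bnd n.+1 isT.
have : l * -1 <= l * c n.+1 by rewrite ler_pM2l.
have : l * c n.+1 <= l * 1 by rewrite ler_pM2l.
by rewrite mulrN mulr1 => -> ->.
Qed.

(** The bound f y + l <= H confines the path to [0, H], and on [a, H] one has f >= f a > a + l, so
    no noise leads out. Between u and a, drift at least l and noise above - l / 2 give the gains of
    l / 2. *)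
Lemma settles_above (a H u : R) (m : nat) :
  (forall y, 0 <= y <= H -> f y + l <= H) ->
  (forall y, a < y <= H -> f a < f y) -> a + l < f a ->
  (forall y, u < y < a -> y + l <= f y) ->
  0 < a -> 0 <= x 0%N <= H -> u < x m ->
  (forall n, exists2 k, (n < k)%N & - 2^-1 < c k) ->
  exists N, forall n, (N <= n)%N -> a <= x n <= H.
Proof.
move=> fH fa_lt fa_gt fu a_gt0 x0H u_xm c_io.
have x_ge n : f (x n) + l * c n.+1 <= x n.+1 by rewrite xS le_max lexx.
have xH n : 0 <= x n <= H.
  elim: n => // n /[dup] /andP[xn0 xnH] /fH fxH.
  rewrite xS le_max lexx orbT ge_max (le_trans xn0 xnH) andbT /=.
  by have /andP[_] := scaled_noise_bound n; lra.
have stay n : a <= x n -> a <= x n.+1.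
  move=> axn; have /andP[xn0 xnH] := xH n.
  have : f a <= f (x n).
    move: axn; rewrite le_eqVlt => /orP[/eqP<-//|axn].
    by apply/ltW/fa_lt; rewrite axn.
  by have /andP[+ _] := scaled_noise_bound n; have := x_ge n; lra.
have [|||N mN aN] :=
    @climb_inf_often R x u a (l / 2) m [set n | - 2^-1 < c n.+1] _ u_xm.
- by rewrite divr_gt0.
- move=> n mn /fu fxn; split=> [|cn].
    by have /andP[+ _] := scaled_noise_bound n; have := x_ge n; lra.
  have : l * - 2^-1 <= l * c n.+1 by rewrite ler_pM2l// ltW.
  by have := x_ge n; lra.
(* Step k is driven by the noise of index k + 1, hence the strict inequality n < k + 1 from
   [c_io]. *)
- by move=> n; have [[|k]// nk ck] := c_io n; exists k.
exists N => n /subnKC <-; elim: (n - N)%N => [|k /andP[axn _]].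
  by rewrite addn0 aN; have /andP[] := xH N.
by rewrite addnS stay//; have /andP[] := xH (N + k).+1.
Qed.

(** The descent of x is the climb of - x from above - v to - b. *)
Lemma descends_below (b v : R) (m : nat) :
  0 < b -> (forall y, b < y < v -> f y + l <= y) -> x m < v ->
  (forall n, exists2 k, (n < k)%N & c k < 2^-1) ->
  exists n, x n <= b.
Proof.
move=> b_gt0 fv xm_v c_io.
have [||||n _] := @climb_inf_often R (fun n => - x n) (- v) (- b) (l / 2) m
    [set n | c n.+1 < 2^-1]; last by rewrite lerN2; exists n.
- by rewrite divr_gt0.
- by rewrite ltrN2.
- move=> n mn; rewrite !ltrN2 andbC => /[dup] /andP[bx _] /fv fxn.
  (* With f + l <= x this gives x >= l, so truncating at 0 does not spoil a drop of l / 2. *)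
  have := f_ge0 _ (ltW (lt_trans b_gt0 bx)) => fx0.
  split=> [|/= cn].
    rewrite lerN2 xS ge_max; apply/andP; split; last by lra.
    by have /andP[_] := scaled_noise_bound n; lra.
  have : l * c n.+1 <= l * 2^-1 by rewrite ler_pM2l// ltW.
  move=> lc; rewrite -lerN2 opprK opprD opprK xS ge_max.
  by apply/andP; split; lra.
- by move=> n; have [[|k]// nk ck] := c_io n; exists k.
Qed.

End Dynamics.

(** * Measurability of the solution and of the events *)

Section Measurability.
Context (R : realType) (d : measure_display) (T : measurableType d)
  (P : probability T R) (chi_ : nat -> {RV P >-> R}) (f : R -> R) (l x0 : R).
Context (f_cont : {within `[0, +oo[, continuous f}) (x0_ge0 : 0 <= x0).

Lemma solution_ge0 n w : 0 <= solution f l chi_ x0 n w.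
Proof. by case: n => // n; rewrite /= le_max lexx orbT. Qed.

Lemma measurable_solution n :
  measurable_fun [set: T] (solution f l chi_ x0 n).
Proof.
elim: n => [|n IH] /=; first exact: measurable_cst.
apply: measurable_maxr; last exact: measurable_cst.
apply: measurable_funD; last by apply: measurable_funM.
(* Continuity of f is given on [0, +oo[ only; the composition is legitimate because the solution is
   nonnegative. *)
have mf : measurable_fun (`[0, +oo[%classic : set R) f.
  exact: subspace_continuous_measurable_fun.
apply: (measurable_comp _ _ mf IH) => //.
by move=> _ [w _ <-] /=; rewrite in_itv/= andbT solution_ge0.
Qed.

Lemma measurable_preimage_solution (I : interval R) n :
  measurable (solution f l chi_ x0 n @^-1` [set` I]).
Proof.
rewrite -[X in measurable X]setTI.
by apply: measurable_solution => //; exact: measurable_itv.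
Qed.

Lemma measurable_settles_in (I : interval R) :
  measurable (settles_in (solution f l chi_ x0) [set` I]).
Proof.
rewrite (_ : settles_in _ _ = \bigcup_N
  \bigcap_(n in [set n | (N <= n)%N]) (solution f l chi_ x0 n @^-1` [set` I])).
  apply: bigcupT_measurable => N; apply: bigcap_measurableType => n _.
  exact: measurable_preimage_solution.
by apply/seteqP; split=> w [N]; [exists N|exists N].
Qed.

Lemma measurable_gets_into (I : interval R) :
  measurable (gets_into (solution f l chi_ x0) [set` I]).
Proof.
rewrite (_ : gets_into _ _ = \bigcup_n (solution f l chi_ x0 n @^-1` [set` I])).
  apply: bigcupT_measurable => n; exact: measurable_preimage_solution.
by apply/seteqP; split=> w [N]; [exists N|exists N].
Qed.

Lemma measurable_block (A : set R) (K : nat) : measurable A ->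
  measurable [set w | forall i, (1 <= i < 1 + K)%N -> A (chi_ i w)].
Proof.
move=> mA; rewrite (_ : [set _ | _] =
  \bigcap_(i in [set i | (1 <= i < 1 + K)%N]) (chi_ i @^-1` A)) //.
by apply: bigcap_measurableType => i _; exact: measurable_funPTI.
Qed.

End Measurability.

(** * Almost sure behaviour of the noise *)

Section Noise.
Context (R : realType) (d : measure_display) (T : measurableType d)
  (P : probability T R) (chi_ : nat -> {RV P >-> R}) (phi : R -> R).
Context (phi_pos : forall x, -1 < x < 1 -> 0 < phi x)
  (phi_out : forall x, ~~ (-1 <= x <= 1) -> phi x = 0)
  (indep : mutually_independent [set n | (1 <= n)%N] chi_)
  (chi_density : forall n, (1 <= n)%N -> has_density (chi_ n) phi).

Lemma same_law (X Y : {RV P >-> R}) (A : set R) :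
  has_density X phi -> has_density Y phi -> measurable A ->
  P (X @^-1` A) = P (Y @^-1` A).
Proof.
by move=> [_ _ XA] [_ _ YA] mA; have := XA A mA; rewrite -YA.
Qed.

(** Collects what the pathwise arguments require: bounded noise, and infinitely many terms
    favourable to the climb and to the descent. *)
Definition typical_noise : set T :=
  [set w | [/\ forall n, (1 <= n)%N -> -1 <= chi_ n w <= 1,
    forall n, exists2 k, (n < k)%N & - 2^-1 < chi_ k w &
    forall n, exists2 k, (n < k)%N & chi_ k w < 2^-1]].

(** An atypical path leaves [-1, 1] at some index, or is eventually at most -1/2, or eventually at
    least 1/2. The first event is null by the density; the other two avoid from some index on ]-1/2,
    0[ and ]0, 1/2[ respectively, each of positive probability. *)
Lemma typical_noise_ae : P.-negligible (~` typical_noise).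
Proof.
have io (A : set R) r s : measurable A -> (forall x, r < x < s -> ~ A x) ->
    -1 <= r -> r < s -> s <= 1 ->
    P.-negligible [set w | exists m, forall i, (m < i)%N -> A (chi_ i w)].
  move=> mA Ars r_ge rs s_le.
  apply: (not_eventually _ _ _ _ _ _ indep mA (P (chi_ 1%N @^-1` A))).
  - exact: (density_lt1 _ _ _ _ phi _ (chi_density _ _) phi_pos _ r s).
  - by move=> n n1; apply: same_law => //; exact: chi_density.
have N1 : P.-negligible
    (\bigcup_n (chi_ n.+1 @^-1` [set y | ~~ (-1 <= y <= 1)])).
  have mB : measurable [set y : R | ~~ (-1 <= y <= 1)].
    rewrite (_ : [set _ | _] = ~` `[-1, 1]%classic).
      by apply: measurableC; exact: measurable_itv.
    by apply/seteqP; split=> y /=; rewrite in_itv/= => /negP.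
  apply: negligible_bigcup => n; apply/negligibleP.
    exact: measurable_funPTI.
  apply: (density_null _ _ _ _ phi) => //; first exact: chi_density.
  by move=> y /=; apply: contra => /andP[/ltW-> /ltW->].
have N2 := io `]-oo, - 2^-1]%classic (- 2^-1) 0 (measurable_itv _).
have N3 := io `[2^-1, +oo[%classic 0 2^-1 (measurable_itv _).
apply: negligibleS (negligibleU N1 (negligibleU (N2 _ _ _ _) (N3 _ _ _ _)));
  try lra; last 2 first.
- by move=> x; rewrite /= in_itv/=; lra.
- by move=> x; rewrite /= in_itv/= andbT; lra.
move=> w; apply: contra_notP => /not_orP[/= n1 /not_orP[/= n2 n3]]; split.
- move=> [|n] // _; apply: contrapT => /negP bad; apply: n1.
  by exists n.
- move=> n; apply: contrapT => /forall2NP nope; apply: n2; exists n => i ni.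
  rewrite /= in_itv/= leNgt; apply/negP; by case: (nope i).
- move=> n; apply: contrapT => /forall2NP nope; apply: n3; exists n => i ni.
  rewrite /= in_itv/= andbT leNgt; apply/negP; by case: (nope i).
Qed.

End Noise.

(** * The persistence and low density bounds *)

Theorem lemma4p3 (R : realType) (d : measure_display) (T : measurableType d)
  (P : probability T R) (P_complete : measure_is_complete P)
  (phi : R -> R)
  (phi_pos : forall x, -1 < x < 1 -> 0 < phi x)
  (phi_out : forall x, ~~ (-1 <= x <= 1) -> phi x = 0)
  (chi_ : nat -> {RV P >-> R})
  (chi_indep : mutually_independent [set n | (1 <= n)%N] chi_)
  (chi_density : forall n, (1 <= n)%N -> has_density (chi_ n) phi)
  (chi_mean : forall n, (1 <= n)%N -> ('E_P[chi_ n] = 0)%E)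
  (chi : {RV P >-> R}) (chi_law : has_density chi phi)
  (f : R -> R)
  (f_ge0 : forall x, 0 <= x -> 0 <= f x)
  (f_cont : {within `[0, +oo[, continuous f})
  (f0 : f 0 = 0)
  (f_gt0 : forall x, 0 < x -> 0 < f x)
  (a H : R) (a_gt0 : 0 < a) (a_lt_H : a < H)
  (fmax_lt_H : fmax f H < H)
  (f_gt_fa : forall x, a < x <= H -> f a < f x)
  (fa_gt_a : a < f a)
  (b1 : R) (b1_gt0 : 0 < b1)
  (f_b1 : forall x, 0 < x < b1 -> f x < x /\ f x <= f b1)
  (b : R) (b_def : b = argminF f a) (b_le_b1 : b <= b1)
  (l : R) (l_gt0 : 0 < l)
  (l_lt_min : l < Num.min (H - fmax f H) (F f a))
  (l_lt_b : l < b - f b)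
  (x0 : R) (x0_range : 0 <= x0 <= H) :
  (alpha_ f a b l < x0 <= H ->
     (persistence_bound chi f a l x0
        <= P (settles_in (solution f l chi_ x0) `[a, H]))%E) /\
  (0 <= x0 < beta_ f a b l ->
     (low_density_bound chi f b l x0
        <= P (gets_into (solution f l chi_ x0) `[0%R, b]))%E).
Proof.
have x0_ge0 : 0 <= x0 by case/andP: x0_range.
have f_cont_itv r s : 0 <= r -> {within `[r, s], continuous f}.
  move=> r_ge0; apply: continuous_subspaceW f_cont.
  by move=> y /=; rewrite !in_itv/= andbT => /andP[/(le_trans r_ge0)].
have F_cont r s : 0 <= r -> {within `[r, s], continuous (F f)}.
  move=> r_ge0 y; apply: continuousB; first exact: f_cont_itv.
  by apply: continuous_subspaceT => z; exact: cvg_id.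
(* The default value of [set_min] would give b = 0, against 0 < l < b - f b; and b = a is excluded
   by f a > a. *)
have [b_gt0 ba Fb] : [/\ 0 < b, b < a & F f b < - l].
  have b_neq0 : b != 0.
    by apply/eqP => b0; move: l_lt_b; rewrite b0 f0 subrr; lra.
  have : [set beta | 0 < beta <= a /\
                     F f beta = set_min (F f @` `[0, a])] b.
    have := b_neq0; rewrite b_def /argminF /set_min.
    by case: xgetP => [y _ [] //|_]; rewrite eqxx.
  move=> [/andP[b_gt0 +] _]; rewrite le_eqVlt => /orP[/eqP ba|ba].
    by move: l_lt_b; rewrite ba; lra.
  by split=> //; rewrite /F; lra.
have [lHf lFa] : l < H - fmax f H /\ l < F f a.
  by move: l_lt_min; rewrite lt_min => /andP[].
have fH y : 0 <= y <= H -> f y + l <= H.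
  move=> yH; have : f y <= fmax f H; last by lra.
  by apply: le_set_max => //; exact: f_cont_itv.
set u := u_ f a l; set v := v_ f b l.
have u_set : has_sup [set u | [/\ 0 <= u, u < a & F f u < l]].
  split; first by exists b; split; lra.
  by exists a => y [_ /ltW].
have bu : b <= u by apply: ub_le_sup; [exact: u_set.2|split; lra].
(* Otherwise y would belong to the set whose supremum is u. *)
have Fu y : u < y < a -> y + l <= f y.
  move=> /andP[uy ya]; rewrite leNgt; apply/negP => Fy.
  have : y <= u; last by lra.
  by apply: ub_le_sup; [exact: u_set.2|split; rewrite /F; lra].
(* The point a is a member, since F a > l > - l. *)
have v_set : has_inf [set v | b < v /\ - l < F f v].
  split; first by exists a; split; lra.
  by exists b => y [/ltW].
have bv : b <= v.
  by apply: lb_le_inf; [exact: v_set.1|move=> y [/ltW]].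
have Fv y : b < y < v -> f y + l <= y.
  move=> /andP[by_ yv]; rewrite leNgt; apply/negP => Fy.
  have : v <= y; last by lra.
  by apply: ge_inf; [exact: v_set.2|split; rewrite /F; lra].
(* Turns the noise thresholds of [p1] and [p2] into displacements (l + A) / 2 and (l - B) / 2. *)
have lM y : l * (y / (2 * l)) = y / 2.
  by field; rewrite gt_eqF.
set x := solution f l chi_ x0.
have xS w n : x n.+1 w = Num.max (f (x n w) + l * chi_ n.+1 w) 0 by [].
have atypN := typical_noise_ae _ _ _ P chi_ phi phi_pos phi_out chi_indep
  chi_density.
have block A K : measurable A ->
    P [set w | forall i, (1 <= i < 1 + K)%N -> A (chi_ i w)] =
    (P (chi @^-1` A) ^+ K)%E.
  move=> mA; apply: indep_block => // n n1.
  exact: (same_law _ _ _ P phi _ _ A (chi_density n n1) chi_law mA).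
split=> _.
- have mS : measurable (settles_in x `[a, H]) by exact: measurable_settles_in.
  (* Covers both a start above u, with m = 0, and a path lifted above u by a favourable block. *)
  have settled w m : typical_noise _ _ _ P chi_ w -> u < x m w ->
      settles_in x `[a, H] w.
    move=> [bnd io _] um.
    have [|N xN] := settles_above R f l (x ^~ w) (chi_ ^~ w) l_gt0
        (xS w) bnd a H u m fH f_gt_fa _ Fu a_gt0 x0_range um io.
      by move: lFa; rewrite /F; lra.
    by exists N => n /xN; rewrite /= in_itv.
  rewrite /persistence_bound -/u; case: ltP => [ux0|x0u].
    rewrite -(@probability_setT _ _ _ P).
    apply: (le_measure_mod_negligible _ _ _ _ _ _ _ _ _ atypN) => // w _.
    have [typ|atyp] := pselect (typical_noise _ _ _ P chi_ w); [left|by right].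
    exact: (settled w 0%N).
  rewrite (_ : p1 _ _ _ _ _ =
    P (chi @^-1` `[1 - (l + A_ f a l x0) / (2 * l), +oo[)); last first.
    by congr (P _); apply/seteqP; split=> w; rewrite /= in_itv/= andbT.
  (* F may touch - l on ]alpha_l, u_l]; then A = - l and K1 contains the junk
     quotient _ / 0, but p1 = P(chi >= 1) = 0. *)
  have [A_le|A_gt] := leP (l + A_ f a l x0) 0.
    rewrite /K1 expeS (density_null _ _ _ _ phi) ?mul0e// => y /=.
    rewrite in_itv/= andbT => le_y; rewrite negb_and -!leNgt; apply/orP; right.
    apply: le_trans le_y; rewrite lerBrDl gerDr.
    by rewrite pmulr_lle0// invr_gt0 mulr_gt0.
  rewrite -block//.
  apply: (le_measure_mod_negligible _ _ _ _ _ _ _ _ _ atypN) => //.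
    exact: measurable_block.
  move=> w Ew.
  have [typ|atyp] := pselect (typical_noise _ _ _ P chi_ w); [left|by right].
  have [||| n xn] := climb_steps _ (x ^~ w) u ((l + A_ f a l x0) / 2)
    (K1 f a l x0).
  - move=> n nK /= /andP[x0n xnu] _; rewrite xS.
    have : A_ f a l x0 <= F f (x n w).
      apply: set_min_le; first exact: F_cont.
      by rewrite x0n.
    have : 1 - (l + A_ f a l x0) / (2 * l) <= chi_ n.+1 w.
      (* Step n uses noise n + 1, and n < K1 is the same as 1 <= n + 1 < 1 + K1. *)
      by have := Ew n.+1 nK; rewrite /= in_itv/= andbT.
    rewrite -(ler_pM2l l_gt0) mulrBr mulr1 lM.
    by rewrite le_max /F => ? ?; apply/orP; left; lra.
  - by rewrite divr_gt0.
  (* The successor in [K1] makes K1 (l + A) / 2 strictly larger than u - x0. *)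
  - have := truncnS_gt (2 * (u - x0) / (l + A_ f a l x0)).
    by rewrite ltr_pdivrMr// -/(K1 f a l x0) mulrA ltr_pdivlMr// mulrC.
  exact: settled xn.
- have mS : measurable (gets_into x `[0, b]) by exact: measurable_gets_into.
  have down w m : typical_noise _ _ _ P chi_ w -> x m w < v ->
      gets_into x `[0, b] w.
    move=> [bnd _ io] xv.
    have [n xn] := descends_below R f l (x ^~ w) (chi_ ^~ w) f_ge0 l_gt0
        (xS w) bnd b v m b_gt0 Fv xv io.
    by exists n; rewrite /= in_itv/= xn andbT; exact: solution_ge0.
  rewrite /low_density_bound -/v; case: ltP => [x0v|vx0].
    rewrite -(@probability_setT _ _ _ P).
    apply: (le_measure_mod_negligible _ _ _ _ _ _ _ _ _ atypN) => // w _.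
    have [typ|atyp] := pselect (typical_noise _ _ _ P chi_ w); [left|by right].
    exact: (down w 0%N).
  rewrite (_ : p2 _ _ _ _ _ =
    P (chi @^-1` `]-oo, - 1 + (l - B_ f b l x0) / (2 * l)])); last first.
    by congr (P _); apply/seteqP; split=> w; rewrite /= in_itv.
  (* If B >= l, the threshold is at most -1 and p2 = 0; as [K2] is a successor, the power is 0
     whatever the quotient in it. *)
  have [B_le|B_gt] := leP (l - B_ f b l x0) 0.
    rewrite /K2 expeS (density_null _ _ _ _ phi) ?mul0e// => y /=.
    rewrite in_itv/= => y_le; rewrite negb_and -!leNgt; apply/orP; left.
    apply: le_trans y_le _; rewrite gerDl.
    by rewrite pmulr_lle0// invr_gt0 mulr_gt0.
  rewrite -block//.
  apply: (le_measure_mod_negligible _ _ _ _ _ _ _ _ _ atypN) => //.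
    exact: measurable_block.
  move=> w Ew.
  have [typ|atyp] := pselect (typical_noise _ _ _ P chi_ w); [left|by right].
  (* For - x the segment [v, x0] is reflected, and each step gains at least - B + l - (l - B) / 2 =
     (l - B) / 2. *)
  have [||| n xn] := climb_steps _ (fun n => - x n w) (- v) ((l - B_ f b l x0) / 2)
    (K2 f b l x0).
  - move=> n nK /= /andP[]; rewrite !lerN2 => xnx0 vxn vxn1.
    have : F f (x n w) <= B_ f b l x0.
      apply: le_set_max; last by rewrite vxn.
      by apply: F_cont; apply: le_trans bv; exact: ltW.
    have : chi_ n.+1 w <= - 1 + (l - B_ f b l x0) / (2 * l).
      by have := Ew n.+1 nK; rewrite /= in_itv/=.
    rewrite -(ler_pM2l l_gt0) mulrDr mulrN1 lM /F => ? ?.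
    (* As x n.+1 >= v >= b > 0, the maximum with 0 is attained by the first term. *)
    have : 0 < x n.+1 w by apply: lt_le_trans (le_trans bv vxn1).
    rewrite xS lt_max ltxx orbF => pos; rewrite (max_idPl (ltW pos)); lra.
  - by rewrite divr_gt0.
  - have := truncnS_gt (2 * (x0 - v) / (l - B_ f b l x0)).
    by rewrite ltr_pdivrMr// -/(K2 f b l x0) mulrA ltr_pdivlMr// (opprK (x 0%N w)) addrC mulrC.
  by apply: (down w n) => //; rewrite -ltrN2.
Qed.
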